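(* For all $n\geq 3$, the number of desarrangements of length $n$ avoiding both $312$ and $321$ is $d_n(312,321)=2^{n-3}$.
   Context: Permutations are in one-line notation. An index $i\in[n-1]$ is a descent of $\pi\in\mathfrak{S}_n$ if $\pi_i>\pi_{i+1}$; $i\in[n]$ is an ascent if it is not a descent (so $n$ is always an ascent). A desarrangement is a permutation whose first ascent is even. $d_n(\Pi)$ is the number of desarrangements in $\mathfrak{S}_n$ avoiding every pattern in $\Pi$ ($\pi$ avoids $\sigma$ if no subsequence of $\pi$ has the same relative order as $\sigma$). *)

(* Defs.v *)
From mathcomp Require Import all_boot all_fingroup.

Set Implicit Arguments.
Unset Strict Implicit.
Unset Printing Implicit Defensive.

(* A permutation of [n] is s : 'S_n; the ordinal i : 'I_n stands for the
   1-based index (or value) i.+1, so s i is the letter in position i.+1. *)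

Section Desarrangements.

Variable n : nat.
Implicit Types (s : 'S_n) (i j : 'I_n).

Definition is_descent s i : bool :=
  [exists j : 'I_n, (val j == i.+1) && (s j < s i)].

(* In particular the last index is always an ascent. *)
Definition is_ascent s i : bool := ~~ is_descent s i.

Definition is_first_ascent s i : bool :=
  is_ascent s i && [forall j : 'I_n, (j < i) ==> ~~ is_ascent s j].

(* Parity is that of the 1-based index i.+1. *)
Definition desarrangement s : bool :=
  [exists i : 'I_n, is_first_ascent s i && ~~ odd i.+1].

(* A pattern is given by its one-line notation, e.g. [:: 3; 1; 2];
   f lists the positions of an occurrence in increasing order. *)
Definition contains s (p : seq nat) : bool :=
  [exists f : {ffun 'I_(size p) -> 'I_n},
    [forall a : 'I_(size p), forall b : 'I_(size p), (a < b) ==> (f a < f b)] &&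
    [forall a : 'I_(size p), forall b : 'I_(size p),
       (s (f a) < s (f b)) == (nth 0 p a < nth 0 p b)]].

Definition avoids s (p : seq nat) : bool := ~~ contains s p.

End Desarrangements.

Definition num_desarr_av (n : nat) (Pi : seq (seq nat)) : nat :=
  #|[set s : 'S_n | desarrangement s && all (avoids s) Pi]|.

(* Main.v *)
Require Import Defs.
From mathcomp Require Import all_boot all_fingroup.
From mathcomp Require Import zify.

Set Implicit Arguments.
Unset Strict Implicit.
Unset Printing Implicit Defensive.

(** A permutation avoids 312 and 321 iff no letter exceeds two letters to its
    right. Hence its first letter is 1 or 2, and deleting that letter is a
    bijection, for each of the two choices, onto the avoiders of length one
    less; so there are [2 ^ (n - 1)] avoiders. An avoider of length at least 3
    has no two consecutive descents at the start, so it is a desarrangement iff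
    its first index is a descent, i.e. iff it starts with 21; the remaining
    letters form an arbitrary avoider of length [n - 2]. *)

Definition few_inversions n (s : 'S_n) : bool :=
  [forall i : 'I_n, forall j : 'I_n, forall k : 'I_n,
    (i < j) && (j < k) ==> ~~ ((s j < s i) && (s k < s i))].

Lemma few_inversionsP n (s : 'S_n) :
  reflect (forall i j k : 'I_n, i < j -> j < k -> s j < s i -> s k < s i -> False)
          (few_inversions s).
Proof.
apply: (iffP forallP) => [h i j k ij jk ji ki | h i].
  by move: (h i) => /forallP/(_ j)/forallP/(_ k); rewrite ij jk ji ki.
apply/forallP => j; apply/forallP => k; apply/implyP => /andP[ij jk].
by apply/negP => /andP[]; exact: h ij jk.
Qed.

(** The six off-diagonal comparisons suffice, since the diagonal ones are false on both sides. *)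
Lemma contains3 n (s : 'S_n) (a b c : nat) (i j k : 'I_n) :
    i < j -> j < k ->
    (s i < s j) = (a < b) -> (s j < s i) = (b < a) ->
    (s i < s k) = (a < c) -> (s k < s i) = (c < a) ->
    (s j < s k) = (b < c) -> (s k < s j) = (c < b) ->
  contains s [:: a; b; c].
Proof.
move=> ij jk h1 h2 h3 h4 h5 h6.
have ik := ltn_trans ij jk.
apply/existsP; exists [ffun x : 'I_3 => tnth [tuple i; j; k] x].
apply/andP; split; apply/forallP=> x; apply/forallP=> y; rewrite !ffunE !(tnth_nth i).
  by case: x y => [[|[|[|x]]] hx] [[|[|[|y]]] hy] //=; apply/implyP.
by case: x y => [[|[|[|x]]] hx] [[|[|[|y]]] hy] //=; rewrite ?ltnn; apply/eqP.
Qed.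

Lemma contains3_inv n (s : 'S_n) (a b c : nat) :
    contains s [:: a; b; c] -> b < a -> c < a ->
  exists i j k : 'I_n, [/\ i < j, j < k, s j < s i & s k < s i].
Proof.
move=> /existsP[f /andP[/forallP inc /forallP pat]] ba ca.
pose x0 : 'I_3 := @Ordinal 3 0 isT; pose x1 : 'I_3 := @Ordinal 3 1 isT.
pose x2 : 'I_3 := @Ordinal 3 2 isT.
exists (f x0), (f x1), (f x2); split.
- by move: (inc x0) => /forallP/(_ x1)/implyP; exact.
- by move: (inc x1) => /forallP/(_ x2)/implyP; exact.
- by move: (pat x1) => /forallP/(_ x0)/eqP->.
- by move: (pat x2) => /forallP/(_ x0)/eqP->.
Qed.

(** 312 and 321 are the two possible orders of a triple whose first letter is the largest, so
    excluding both leaves no condition on the last two letters. *)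
Lemma avoids_312_321 n (s : 'S_n) :
  all (avoids s) [:: [:: 3; 1; 2]; [:: 3; 2; 1]] = few_inversions s.
Proof.
rewrite /= andbT /avoids -negb_or; apply/idP/few_inversionsP.
  move=> /norP[c1 c2] i j k ij jk ji ki.
  have njk : s j != s k :> nat.
    by rewrite (inj_eq val_inj) (inj_eq perm_inj) -(inj_eq val_inj) /= ltn_eqF.
  have [jk'|kj'|e] := ltngtP (s j) (s k); last by rewrite e eqxx in njk.
    by move/negP: c1; apply; apply: (contains3 ij jk); apply/idP/idP; lia.
  by move/negP: c2; apply; apply: (contains3 ij jk); apply/idP/idP; lia.
move=> h; apply/norP; split; apply/negP => /contains3_inv.
  by move=> [] // i [j [k [ij jk ji ki]]]; exact: h ij jk ji ki.
by move=> [] // i [j [k [ij jk ji ki]]]; exact: h ij jk ji ki.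
Qed.

(** Together with [lift_perm_surj], this makes deletion of the letter in position [i] a bijection: a
    permutation amounts to that letter and the standardized rest. *)
Lemma lift_perm_inj2 n (i : 'I_n.+1) (v w : 'I_n.+1) (t u : 'S_n) :
  lift_perm i v t = lift_perm i w u -> v = w /\ t = u.
Proof.
move=> e.
have evw : v = w by rewrite -(lift_perm_id i v t) e lift_perm_id.
split=> //; apply/permP => k; apply: (@lift_inj _ v).
by rewrite -(lift_perm_lift i v t) e lift_perm_lift evw.
Qed.

Lemma lift_perm_surj n (i : 'I_n.+1) (s : 'S_n.+1) :
  exists t : 'S_n, s = lift_perm i (s i) t.
Proof.
(* The default [k] is never taken: [lift i k] differs from [i], so its image differs from [s i]. *)
pose f k := odflt k (unlift (s i) (s (lift i k))).
have fK k : lift (s i) (f k) = s (lift i k).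
  rewrite /f; case: unliftP => [j -> //|/perm_inj e].
  by move: (neq_lift i k); rewrite e eqxx.
have f_inj : injective f.
  by move=> j k e; apply/(@lift_inj _ i)/(@perm_inj _ s); rewrite -!fK e.
exists (perm f_inj); apply/permP => k.
case: (unliftP i k) => [j ->|->]; last by rewrite lift_perm_id.
by rewrite lift_perm_lift permE fK.
Qed.

Lemma ltn_lift n (v : 'I_n.+1) (x y : 'I_n) : (lift v x < lift v y) = (x < y).
Proof. by rewrite /= /bump; lia. Qed.

(** Counting from 0, the first letter [v] exceeds exactly [v] later letters; triples beginning
    further right are those of [t], as [lift] preserves order. *)
Lemma few_inversions_lift n (v : 'I_n.+1) (t : 'S_n) :
  few_inversions (lift_perm ord0 v t) = (v <= 1) && few_inversions t.
Proof.
set u := lift_perm ord0 v t.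
have u0 : u ord0 = v by rewrite lift_perm_id.
apply/few_inversionsP/andP => [h | [v1 /few_inversionsP h] i j k].
  split.
    rewrite leqNgt; apply/negP => v2; have vn := ltn_ord v.
    (* If [v] is at least 2, the values 0 and 1 both lie below it and to its right; they give a
       forbidden triple in whichever order they occur. *)
    pose x : 'I_n.+1 := Ordinal (ltn_trans (ltn_trans (ltn0Sn 0) v2) vn).
    pose y : 'I_n.+1 := Ordinal (ltn_trans v2 vn).
    have ux : u (u^-1 x)%g = x by rewrite permKV.
    have uy : u (u^-1 y)%g = y by rewrite permKV.
    have pos z : u z < v -> 0 < z.
      move=> zv; rewrite lt0n; apply/negP => /eqP z0.
      by move: zv; rewrite -u0 (_ : z = ord0) ?ltnn //; exact: val_inj.
    have xp : 0 < (u^-1 x)%g by apply: pos; rewrite ux /=; lia.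
    have yp : 0 < (u^-1 y)%g by apply: pos; rewrite uy /=; lia.
    have [xy|yx|e] := ltngtP ((u^-1 x)%g : nat) ((u^-1 y)%g : nat).
    - by apply: (h ord0 _ _ xp xy); rewrite ?ux ?uy u0 /=; lia.
    - by apply: (h ord0 _ _ yp yx); rewrite ?ux ?uy u0 /=; lia.
    - by have := congr1 val (perm_inj (val_inj e)).
  apply/few_inversionsP => i j k ij jk ji ki.
  by apply: (h (lift ord0 i) (lift ord0 j) (lift ord0 k)) => //;
    rewrite !lift_perm_lift ltn_lift.
move=> ij jk.
case: (unliftP ord0 j) => [j' ej|ej]; last by rewrite ej in ij.
case: (unliftP ord0 k) => [k' ek|ek]; last by rewrite ek in jk.
case: (unliftP ord0 i) => [i' ei|->]; last first.
  (* Two later letters below [v <= 1] would both be 0, against injectivity. *)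
  rewrite u0 => /leq_trans/(_ v1) uj /leq_trans/(_ v1) uk.
  have : u j = u k.
    apply: val_inj; move: uj uk; rewrite !ltnS !leqn0.
    by move=> /eqP uj /eqP uk; rewrite /= uj uk.
  by move=> /perm_inj e; rewrite e ltnn in jk.
move: ij jk; rewrite {}ei {}ej {}ek /u !lift_perm_lift !ltn_lift => ij jk.
exact: h.
Qed.

Lemma card_few_inversions n : #|[set s : 'S_n.+1 | few_inversions s]| = 2 ^ n.
Proof.
elim: n => [|n IHn].
  rewrite (_ : [set _ | _] = setT) ?cardsT ?card_Sn //.
  apply/setP => s; rewrite !inE; apply/few_inversionsP => i j k.
  by rewrite !ord1.
(* The boolean encodes the first letter, 0 or 1, so that the domain of [f] has twice as many
   avoiders. *)
pose v (b : bool) : 'I_n.+2 := inord b.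
have vE b : v b = b :> nat by rewrite inordK //; case: b.
pose f (bt : bool * 'S_n.+1) := lift_perm ord0 (v bt.1) bt.2.
have f_inj : injective f.
  move=> [b t] [c u] /lift_perm_inj2[/(congr1 val) /= + ->].
  by rewrite !vE => e; congr pair; case: b c e => [] [].
rewrite expnS -IHn -card_bool -cardsT -cardsX -(card_imset _ f_inj).
congr #|pred_of_set _|; apply/setP => s; rewrite inE; apply/idP/imsetP.
  have [t ->] := lift_perm_surj ord0 s.
  rewrite few_inversions_lift => /andP[s1 ht].
  exists (s ord0 == 1 :> nat, t); first by rewrite !inE.
  rewrite /f /=; congr lift_perm; apply: val_inj; rewrite /= vE.
  by case: (s ord0 : nat) s1 => [|[|]].
move=> [[b t]]; rewrite !inE /= => ht ->.
by rewrite few_inversions_lift vE ht leq_b1.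
Qed.

Lemma desarrangement_few_inversions n (s : 'S_n.+3) :
  few_inversions s -> desarrangement s = (s (lift ord0 ord0) < s ord0).
Proof.
move=> /few_inversionsP h; set o1 := lift _ _.
apply/existsP/idP => [[i /andP[/andP[_ /forallP fa] ev]] | s10].
  (* The 1-based index [i.+1] is even, so [i] is not the first position, which is therefore a
     descent. *)
  have i0 : 0 < i by case: (i : nat) ev.
  move: (fa ord0); rewrite i0 negbK => /existsP[j /andP[/eqP j1 sj]].
  by rewrite (_ : o1 = j) //; apply: val_inj; rewrite /= j1.
(* [o1] is the 1-based index 2. A descent there would put two letters below the first one. *)
exists o1; rewrite andbT; apply/andP; split.
  apply/existsP => -[j /andP[/eqP j2 sj]].
  apply: (h ord0 o1 j) => //; first by rewrite j2.
  exact: ltn_trans sj s10.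
apply/forallP => j; apply/implyP; rewrite ltnS leqn0 negbK => /eqP j0.
apply/existsP; exists o1; rewrite j0 eqxx /= (_ : j = ord0) //.
exact: val_inj.
Qed.

Theorem theorem3p16 (n : nat) (hn : 3 <= n) :
  num_desarr_av n [:: [:: 3; 1; 2]; [:: 3; 2; 1]] = 2 ^ (n - 3).
Proof.
case: n hn => [|[|[|n]]] // _; rewrite -addn3 addnK addn3.
rewrite -card_few_inversions /num_desarr_av.
pose o1 : 'I_n.+3 := lift ord0 ord0.
(* [f] prepends 21: the inner 0 stays 0 when lifted past the value [o1], that is 1. *)
pose f (t : 'S_n.+1) := lift_perm ord0 o1 (lift_perm ord0 ord0 t).
have f_inj : injective f by move=> t u /lift_perm_inj2[_ /lift_perm_inj2[]].
rewrite -(card_imset _ f_inj); congr #|pred_of_set _|.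
apply/setP => s; rewrite inE avoids_312_321; apply/andP/imsetP => [[ds fs] | [t]].
  move: ds; rewrite desarrangement_few_inversions //.
  move: fs; have [t ->] := lift_perm_surj ord0 s.
  have [u ->] := lift_perm_surj ord0 t.
  rewrite !few_inversions_lift lift_perm_lift !lift_perm_id.
  move=> /andP[s1 /andP[t1 fu]] st.
  (* [st] forces [t ord0 < s ord0], and [s ord0] is at most 1. *)
  have st0 : s ord0 = o1 by apply: val_inj; move: st; rewrite /= /bump; lia.
  have t0 : t ord0 = ord0 by apply: val_inj; move: st; rewrite /= /bump; lia.
  by exists u; rewrite ?inE // st0 t0.
rewrite inE => ft ->.
have ff : few_inversions (f t) by rewrite !few_inversions_lift.
by rewrite desarrangement_few_inversions // lift_perm_lift !lift_perm_id.
Qed.
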